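(* For every computably enumerable set $A\subseteq\mathbb{N}$ there exists a regainingly approximable set $B\subseteq\mathbb{N}$ with $A\equiv_T B$ (i.e., $A$ and $B$ are Turing equivalent).
   Context: A real number $\alpha$ is regainingly approximable if there exists a computable nondecreasing sequence of rational numbers $(a_n)_n$ converging to $\alpha$ such that $\alpha-a_n<2^{-n}$ holds for infinitely many $n\in\mathbb{N}$. For $A\subseteq\mathbb{N}$ let $2^{-A}:=\sum_{a\in A}2^{-(a+1)}$. A set $A\subseteq\mathbb{N}$ is called regainingly approximable if it is computably enumerable and the real number $2^{-A}$ is regainingly approximable. *)

(* Defs.v *)
From mathcomp Require Import all_boot all_order all_algebra.
From mathcomp Require Import all_classical all_reals all_analysis.

Set Implicit Arguments.
Unset Strict Implicit.
Unset Printing Implicit Defensive.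

Import Order.TTheory GRing.Theory Num.Theory.
Import numFieldNormedType.Exports.

Local Open Scope classical_set_scope.
Local Open Scope ring_scope.

(** Partial functions from [nat^n] to [nat] are represented by their graphs. *)
Definition pfun (n : nat) := n.-tuple nat -> nat -> Prop.

Definition comp_graph n m (f : pfun m) (g : 'I_m -> pfun n) : pfun n :=
  fun x y => exists u : m.-tuple nat, (forall i, g i x (tnth u i)) /\ f u y.

Fixpoint primrec_graph n (f : pfun n) (g : pfun n.+2) (x : n.-tuple nat)
    (k y : nat) : Prop :=
  if k is k'.+1 then
    exists r, primrec_graph f g x k' r /\ g [tuple of k' :: r :: x] y
  else f x y.

(** Unbounded search is defined at [x] with value [y] only if [f] is defined at
    all [(i, x)] with [i <= y]. *)
Definition min_graph n (f : pfun n.+1) : pfun n :=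
  fun x y => f [tuple of y :: x] 0%N /\
    forall i, (i < y)%N -> exists v, f [tuple of i :: x] v.+1.

(** The partial recursive functions, in the absolute sense for [X = None], and
    relative to the oracle set [A] for [X = Some A]: in the latter case the
    characteristic function of [A] is an additional initial function. *)
Inductive partial_recursive (X : option (set nat)) :
    forall n, pfun n -> Prop :=
| pr_zero n : partial_recursive X (fun (_ : n.-tuple nat) y => y = 0%N)
| pr_succ : partial_recursive X (fun (x : 1.-tuple nat) y => y = (thead x).+1)
| pr_proj n (i : 'I_n) : partial_recursive X (fun x y => y = tnth x i)
| pr_oracle (A : set nat) : X = Some A ->
    partial_recursive X
      (fun (x : 1.-tuple nat) y => y = nat_of_bool (thead x \in A))
| pr_comp n m (f : pfun m) (g : 'I_m -> pfun n) :
    partial_recursive X f -> (forall i, partial_recursive X (g i)) ->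
    partial_recursive X (comp_graph f g)
| pr_primrec n (f : pfun n) (g : pfun n.+2) :
    partial_recursive X f -> partial_recursive X g ->
    partial_recursive X
      (fun x : n.+1.-tuple nat =>
         primrec_graph f g [tuple of behead x] (thead x))
| pr_min n (f : pfun n.+1) :
    partial_recursive X f -> partial_recursive X (min_graph f).

Definition recursive_fun (X : option (set nat)) (f : nat -> nat) : Prop :=
  exists F : pfun 1, partial_recursive X F /\
    forall (x : 1.-tuple nat) y, F x y <-> y = f (thead x).

Definition computable (f : nat -> nat) : Prop := recursive_fun None f.

Definition turing_reducible (A B : set nat) : Prop :=
  recursive_fun (Some B) (fun n => nat_of_bool (n \in A)).

Definition turing_equivalent (A B : set nat) : Prop :=
  turing_reducible A B /\ turing_reducible B A.

Definition computably_enumerable (A : set nat) : Prop :=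
  A = set0 \/ exists f : nat -> nat, computable f /\ A = range f.

Definition computable_rat_seq (a : nat -> rat) : Prop :=
  exists s p q : nat -> nat,
    [/\ computable s, computable p, computable q &
      forall n, a n = (-1) ^+ s n * (p n)%:R / (q n).+1%:R].

Definition regainingly_approximable (R : realType) (alpha : R) : Prop :=
  exists a : nat -> rat,
    [/\ computable_rat_seq a,
        nondecreasing_seq a,
        (fun n => ratr (a n) : R) @ \oo --> alpha &
        infinite_set [set n : nat | alpha - ratr (a n) < 2 ^- n]].

Definition two_pow_neg (R : realType) (A : set nat) : R :=
  \big[+%R/0]_(0 <= a <oo | a \in A) (2 ^- a.+1 : R).

Definition regainingly_approximable_set (R : realType) (A : set nat) : Prop :=
  computably_enumerable A /\ regainingly_approximable (two_pow_neg R A).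

(* Main.v *)
Require Import Defs.
From mathcomp Require Import all_boot all_order all_algebra.
From mathcomp Require Import all_classical all_reals all_analysis.
From mathcomp Require Import zify ring lra.

(** If [A] is finite, take [B = A]. Otherwise let [A] be the range of a
    computable [f], and let [B] be Dekker's deficiency set, the set of stages [s]
    after which a new element smaller than [f s] appears. If [s] is not in [B],
    then [A] below [f s] is settled at stage [s], so [B] computes [A]; and [s] is
    in [B] iff some element of [A] below [f s] is not listed up to stage [s], so
    [A] computes [B]. Infinitely many stages [n] are not deficient and list a
    fresh element. At such an [n], every deficient [s <= n] is already recognized
    as such by stage [n]: if a witness [t] for [s] has a value not listed up to
    [n], then [f n < f t < f s], and [n] itself is a witness.
    So the sum over the elements of [B] up to [n] recognized by stage [n] misses [2^{-B}] by at most [2^-(n+1)]. *)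

Set Implicit Arguments.
Unset Strict Implicit.
Unset Printing Implicit Defensive.

Import Order.TTheory GRing.Theory Num.Theory.
Import numFieldNormedType.Exports.

(** * Closure properties of the total recursive functions *)

(* Arguments are passed as sequences, so that binding a variable is a mere
   [cons]; only sequences of size [n] matter. *)
Definition recursive_seq (X : option (set nat)) n (F : seq nat -> nat) : Prop :=
  partial_recursive X (fun (x : n.-tuple nat) y => y = F x).

Section Closure.
Variable X : option (set nat).

(** The constructors of [partial_recursive] produce graphs of a fixed shape; extensionality lets any
    equivalent graph take their place. *)
Lemma pfun_ext n (f g : pfun n) : (forall x y, f x y <-> g x y) ->
  partial_recursive X f -> partial_recursive X g.
Proof.
by move=> fg; have -> : f = g by apply/funext => x; apply/funext => y; exact/propext.
Qed.

Lemma recursive_seq_ext n F G : (forall x, size x = n -> F x = G x) ->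
  recursive_seq X n F -> recursive_seq X n G.
Proof. by move=> FG; apply: pfun_ext => x y; rewrite FG ?size_tuple. Qed.

Lemma recursive_var n i : (i < n)%N -> recursive_seq X n (fun x => nth 0%N x i).
Proof.
move=> lt_in; apply: pfun_ext (pr_proj X (Ordinal lt_in)) => x y.
by rewrite (tnth_nth 0%N).
Qed.

(** Indexing [G] by all naturals instead of ['I_m] lets it be given by cases; only its values below
    [m] count. *)
Lemma recursive_comp m n F (G : nat -> seq nat -> nat) : recursive_seq X m F ->
  (forall i, (i < m)%N -> recursive_seq X n (G i)) ->
  recursive_seq X n (fun x => F (mkseq (G^~ x) m)).
Proof.
move=> recF recG.
have recG' (i : 'I_m) : recursive_seq X n (G i) by exact: recG.
apply: pfun_ext (pr_comp recF recG') => x y; split.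
- case=> u [Gu ->]; congr F; apply: (@eq_from_nth _ 0%N).
    by rewrite size_mkseq size_tuple.
  move=> i; rewrite size_tuple => lt_im.
  by rewrite nth_mkseq // -(Gu (Ordinal lt_im)) (tnth_nth 0%N).
- move=> ->; exists (mktuple (fun i : 'I_m => G i x)); split=> [i|].
    by rewrite tnth_mktuple.
  congr F; apply: (@eq_from_nth _ 0%N); first by rewrite size_mkseq size_tuple.
  move=> i; rewrite size_mkseq => lt_im.
  rewrite nth_mkseq // -[i]/(val (Ordinal lt_im)) -tnth_nth.
  by rewrite tnth_mktuple.
Qed.

Lemma recursive_app1 n (f : nat -> nat) G :
  recursive_seq X 1 (fun x => f (nth 0 x 0)%N) -> recursive_seq X n G ->
  recursive_seq X n (fun x => f (G x)).
Proof. by move=> recf recG; apply: (recursive_comp (G := fun=> G) recf). Qed.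

Lemma recursive_app2 n (f : nat -> nat -> nat) G H :
  recursive_seq X 2 (fun x => f (nth 0 x 0) (nth 0 x 1))%N ->
  recursive_seq X n G -> recursive_seq X n H ->
  recursive_seq X n (fun x => f (G x) (H x)).
Proof.
move=> recf recG recH.
by apply: (recursive_comp (G := fun i => if i is 0%N then G else H) recf) => -[].
Qed.

Lemma recursive_cons n F h : recursive_seq X n.+1 F -> recursive_seq X n h ->
  recursive_seq X n (fun x => F (h x :: x)).
Proof.
move=> recF rech.
pose G i := if i is j.+1 then fun x => nth 0%N x j else h.
have recG i : (i < n.+1)%N -> recursive_seq X n (G i).
  by case: i => [|i] // lt_in; exact: recursive_var.
apply: recursive_seq_ext (recursive_comp recF recG) => x sx.
congr F; apply: (@eq_from_nth _ 0%N) => [|i]; rewrite size_mkseq /= ?sx //.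
by move=> lt_in; rewrite nth_mkseq //; case: i {lt_in}.
Qed.

Lemma recursive_succ n G : recursive_seq X n G ->
  recursive_seq X n (fun x => (G x).+1).
Proof.
apply: recursive_app1; apply: pfun_ext (pr_succ X) => x y.
by rewrite /thead (tnth_nth 0%N).
Qed.

Lemma recursive_const n c : recursive_seq X n (fun=> c).
Proof.
elim: c => [|c IHc]; last exact: recursive_succ.
by apply: pfun_ext (pr_zero X n).
Qed.

(** The recursion argument [h x] is passed as an extra first variable. In the step function,
    [drop 2] strips the counter and the accumulator from the parameters. *)
Lemma recursive_nat_rect n F (G : nat -> nat -> seq nat -> nat) h :
  recursive_seq X n F ->
  recursive_seq X n.+2 (fun x => G (nth 0 x 0) (nth 0 x 1) (drop 2 x))%N ->
  recursive_seq X n h ->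
  recursive_seq X n (fun x => nat_rect _ (F x) (fun k r => G k r x) (h x)).
Proof.
move=> recF recG rech.
pose H s := nat_rect (fun=> nat) (F (behead s)) (fun k r => G k r (behead s))
  (nth 0%N s 0).
suff recH : recursive_seq X n.+1 H.
  exact: recursive_cons recH rech.
apply: pfun_ext (pr_primrec recF recG) => x y.
rewrite /H; case/tupleP: x => k x; rewrite theadE.
rewrite (_ : [tuple of behead [tuple of k :: x]] = x); last exact: val_inj.
rewrite /=; elim: k y => [|k IHk] y //=; split.
  by case=> r [/IHk -> ->]; rewrite drop0.
by move=> ->; eexists; split; [exact/IHk|rewrite /= drop0].
Qed.

(** Unbounded search looks for a zero, hence the negated test. The second hypothesis says that the
    search succeeds everywhere, with result [h]. *)
Lemma recursive_mu n (p : nat -> seq nat -> bool) h :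
  recursive_seq X n.+1 (fun x => nat_of_bool (~~ p (nth 0 x 0)%N (behead x))) ->
  (forall x, size x = n -> p (h x) x /\ forall i, (i < h x)%N -> ~~ p i x) ->
  recursive_seq X n h.
Proof.
move=> recp hP; apply: pfun_ext (pr_min recp) => x y /=.
have [ph hmin] := hP x (size_tuple x); split=> [[py ymin]|->].
  have {}py : p y x by move: py => /=; case: (p y x).
  case: (ltngtP y (h x)) => // [/hmin|/ymin [v /=]]; first by rewrite py.
  by rewrite ph.
split=> /=; first by rewrite ph.
(* Below [h x] the negated test has value 1, which is [v.+1] for [v = 0]. *)
by move=> i /hmin pi; exists 0%N => /=; rewrite pi.
Qed.

Lemma recursive_add n G H : recursive_seq X n G -> recursive_seq X n H ->
  recursive_seq X n (fun x => G x + H x)%N.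
Proof.
move=> recG recH.
apply: recursive_seq_ext (recursive_nat_rect (G := fun _ r _ => r.+1) recG _ recH).
  by move=> x _; elim: (H x) => [|k /= ->]; rewrite ?addn0 ?addnS.
by apply: recursive_succ; exact: recursive_var.
Qed.

Lemma recursive_mul n G H : recursive_seq X n G -> recursive_seq X n H ->
  recursive_seq X n (fun x => G x * H x)%N.
Proof.
apply: recursive_app2 => {G H}.
have rec0 := recursive_const 2 0; have rec1 := @recursive_var 2 1 isT.
apply: recursive_seq_ext
  (recursive_nat_rect (G := fun _ r x => (r + nth 0 x 0)%N) rec0 _ rec1).
  by move=> x _; elim: (nth 0%N x 1) => [|k /= ->]; rewrite ?muln0 // mulnSr.
apply: recursive_add; first exact: recursive_var.
by apply: recursive_seq_ext (@recursive_var 4 2 isT) => x _; rewrite nth_drop.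
Qed.

Lemma recursive_pred n G : recursive_seq X n G ->
  recursive_seq X n (fun x => (G x).-1).
Proof.
move=> recG; have rec0 := recursive_const n 0.
apply: recursive_seq_ext (recursive_nat_rect (G := fun k _ _ => k) rec0 _ recG).
  by move=> x _; case: (G x).
exact: recursive_var.
Qed.

Lemma recursive_sub n G H : recursive_seq X n G -> recursive_seq X n H ->
  recursive_seq X n (fun x => G x - H x)%N.
Proof.
move=> recG recH.
apply: recursive_seq_ext (recursive_nat_rect (G := fun _ r _ => r.-1) recG _ recH).
  by move=> x _; elim: (H x) => [|k /= ->]; rewrite ?subn0 ?subnS.
by apply: recursive_pred; exact: recursive_var.
Qed.

Lemma recursive_neg n (p : seq nat -> bool) : recursive_seq X n p ->
  recursive_seq X n (fun x => ~~ p x).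
Proof.
move=> recp; apply: recursive_seq_ext (recursive_sub (recursive_const n 1) recp).
by move=> x _; case: (p x).
Qed.

Lemma recursive_and n (p q : seq nat -> bool) : recursive_seq X n p ->
  recursive_seq X n q -> recursive_seq X n (fun x => p x && q x).
Proof.
move=> recp recq; apply: recursive_seq_ext (recursive_mul recp recq) => x _.
by rewrite mulnb.
Qed.

Lemma recursive_leq n G H : recursive_seq X n G -> recursive_seq X n H ->
  recursive_seq X n (fun x => G x <= H x)%N.
Proof.
move=> recG recH; have rec1 := recursive_const n 1.
apply: recursive_seq_ext (recursive_sub rec1 (recursive_sub recG recH)) => x _.
by rewrite -subn_eq0; case: (G x - H x)%N.
Qed.

Lemma recursive_eq n G H : recursive_seq X n G -> recursive_seq X n H ->
  recursive_seq X n (fun x => G x == H x).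
Proof.
move=> recG recH; apply: recursive_seq_ext
  (recursive_and (recursive_leq recG recH) (recursive_leq recH recG)) => x _.
by rewrite eqn_leq.
Qed.

Lemma recursive_if n (p : seq nat -> bool) G H : recursive_seq X n p ->
  recursive_seq X n G -> recursive_seq X n H ->
  recursive_seq X n (fun x => if p x then G x else H x).
Proof.
move=> recp recG recH; apply: recursive_seq_ext (recursive_add
  (recursive_mul recp recG) (recursive_mul (recursive_neg recp) recH)) => x _.
by case: (p x); rewrite !(mul1n, mul0n) ?addn0.
Qed.

(** Bounded search is a primitive recursion whose accumulator is the disjunction so far, written
    with negation and conjunction by De Morgan. *)
Lemma recursive_has n (p : nat -> seq nat -> bool) b :
  recursive_seq X n.+1 (fun x => p (nth 0 x 0)%N (behead x)) ->
  recursive_seq X n b ->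
  recursive_seq X n (fun x => has (p^~ x) (iota 0 (b x))).
Proof.
move=> recp recb; have rec0 := recursive_const n 0.
pose G k r x := nat_of_bool (~~ (~~ (0 < r)%N && ~~ p k x)).
apply: recursive_seq_ext (recursive_nat_rect (G := G) rec0 _ recb).
  move=> x _; elim: (b x) => [|k IHk] //.
  rewrite [LHS]/= IHk -[k.+1 in RHS]addn1 iotaD has_cat /= orbF /G.
  by rewrite lt0b negb_and !negbK add0n.
rewrite /G; apply: recursive_neg; apply: recursive_and; apply: recursive_neg.
  by apply: recursive_leq; [exact: recursive_const|exact: recursive_var].
(* The test must not see the accumulator, so [H] skips position 1. *)
pose H i : seq nat -> nat := fun x => nth 0%N x (if i is 0%N then 0 else i.+1)%N.
have recH i : (i < n.+1)%N -> recursive_seq X n.+2 (H i).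
  by case: i => [|i] lt_in; exact: recursive_var.
apply: recursive_seq_ext (recursive_comp recp recH) => x sx /=.
congr (nat_of_bool (p _ _)); apply: (@eq_from_nth _ 0%N) => [|i].
  by rewrite size_map size_iota size_drop sx subn2.
rewrite size_map size_iota => lt_in.
by rewrite (nth_map 0%N) ?size_iota // nth_iota // nth_drop.
Qed.

Lemma recursive_fun_seq f :
  recursive_fun X f <-> recursive_seq X 1 (fun x => f (nth 0 x 0)%N).
Proof.
split=> [[F [recF FP]]|recf].
  by apply: pfun_ext recF => x y; rewrite FP /thead (tnth_nth 0%N).
by exists (fun x y => y = f (nth 0 x 0)%N); split=> // x y; rewrite /thead (tnth_nth 0%N).
Qed.

End Closure.

(** Every constructor except the oracle is available for any [X], and the oracle one cannot occur
    since [None] is no [Some A]. *)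
Lemma partial_recursive_relative X n (f : pfun n) :
  partial_recursive None f -> partial_recursive X f.
Proof.
elim=> {n f}; [exact: pr_zero|exact: pr_succ|exact: pr_proj|by []|..].
- by move=> n m f g _ IHf _ IHg; exact: pr_comp.
- by move=> n f g _ IHf _ IHg; exact: pr_primrec.
- by move=> n f _ IHf; exact: pr_min.
Qed.

Lemma recursive_mem (B : set nat) n G : recursive_seq (Some B) n G ->
  recursive_seq (Some B) n (fun x => nat_of_bool (G x \in B)).
Proof.
apply: (@recursive_app1 _ _ (fun m => nat_of_bool (m \in B))).
by apply: pfun_ext (@pr_oracle (Some B) B erefl) => x y; rewrite /thead (tnth_nth 0%N).
Qed.

Lemma turing_reducible_refl A : turing_reducible A A.
Proof. by apply/recursive_fun_seq/recursive_mem; exact: recursive_var. Qed.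

(** * Sets with a decidable increasing approximation *)

(** The bound [b <= n] makes every stage a finite set, whose sum is a dyadic rational, and allows a
    simple coding of the pairs. *)
Definition approximated_by (C : set nat) (E : nat -> nat -> bool) : Prop :=
  [/\ recursive_seq None 2 (fun x => E (nth 0 x 0) (nth 0 x 1))%N,
      forall b n, E b n -> (b <= n)%N,
      forall b n, E b n -> E b n.+1 &
      C = [set b | exists n, E b n]%classic].

Lemma approximated_by_ce C E : approximated_by C E -> computably_enumerable C.
Proof.
move=> [recE E_le _ ->].
have [[c [m Ecm]]|C0] := pselect (exists c m, E c m); last first.
  by left; rewrite -subset0 => b [n Ebn]; apply: C0; exists b, n.
right.
(* The least such [t] is the integer square root of [k]. *)
have sqrtP k : exists t, (k < t.+1 * t.+1)%N by exists k; rewrite mulnS; lia.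
pose t k := ex_minn (sqrtP k).
have rect : recursive_seq None 1 (fun x => t (nth 0%N x 0)).
  apply: (recursive_mu (p := fun t x => nth 0 x 0 < t.+1 * t.+1)%N).
    apply: recursive_neg; apply: recursive_leq; last first.
      by apply: recursive_mul; apply: recursive_succ; exact: recursive_var.
    apply: recursive_succ.
    by apply: recursive_seq_ext (@recursive_var _ 2 1 isT) => x _; rewrite nth_behead.
  move=> x _; rewrite /t; case: ex_minnP => n lt_n n_min; split=> // i lt_in.
  by apply/negP => /n_min; rewrite leqNgt lt_in.
(* Stage [k = n * n + b] with [b <= n] tests whether [E b n]. *)
pose s k := (k - t k * t k)%N.
(* When the test fails, the known element [c] is output, which keeps the function total with range
   inside [C]. *)
exists (fun k => if E (s k) (t k) then s k else c); split.
  apply/recursive_fun_seq.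
  have recs : recursive_seq None 1 (fun x => s (nth 0%N x 0)).
    apply: recursive_sub; first exact: recursive_var.
    exact: recursive_mul.
  apply: recursive_if => //; last exact: recursive_const.
  exact: (recursive_app2 (f := fun b n => nat_of_bool (E b n))).
apply/seteqP; split=> [b [n Ebn]|_ [k _ <-]] /=; last first.
  by case: ifPn => [Ek|_]; [exists (t k)|exists m].
exists (n * n + b)%N => //=.
have bn := E_le _ _ Ebn.
(* Since [b <= n], the code lies between [n^2] and [n^2 + n], hence below [(n + 1)^2]. *)
have tE : t (n * n + b)%N = n.
  rewrite /t; case: ex_minnP => i lt_i i_min.
  have := i_min n; have : ~~ (i.+1 <= n)%N by apply/negP => lein; nia.
  by move=> *; nia.
by rewrite /s tE addKn Ebn.
Qed.

Lemma infinite_set_natP (S : set nat) :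
  (forall N, exists2 n, (N <= n)%N & S n) -> infinite_set S.
Proof.
move=> unbS /finite_seqP[s SE]; have [n lt_n Sn] := unbS (\max_(i <- s) i).+1.
move: Sn; rewrite SE /= => /(@leq_bigmax_seq _ s xpredT id) /(_ isT).
by rewrite leqNgt lt_n.
Qed.

(** * Regaining approximations from infinitely many settled stages *)

Section Regaining.
Local Open Scope ring_scope.
Local Open Scope classical_set_scope.
Variables (R : realType) (C : set nat).

Let S n : R := \sum_(0 <= b < n | b \in C) 2 ^- b.+1.

Let S_nd : nondecreasing_seq S.
Proof.
apply/nondecreasing_seqP => n; rewrite /S big_mkcond [leRHS]big_mkcond big_nat_recr //=.
by rewrite lerDl; case: ifP => // _; rewrite invr_ge0 exprn_ge0.
Qed.

(** The terms with [m <= b < n] add up to at most a geometric sum, which equals [2^-m - 2^-n]. *)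
Let S_tail m n : (m <= n)%N -> S n <= S m + 2 ^- m - 2 ^- n.
Proof.
move=> /subnKC <-; elim: (n - m)%N => [|k IHk]; first by rewrite addn0 addrK.
rewrite addnS {1}/S big_mkcond big_nat_recr //= -big_mkcond -/(S _).
move: IHk; have -> : 2 ^- (m + k)%N = 2 ^- (m + k).+1 + 2 ^- (m + k).+1 :> R.
  by rewrite exprS invfM; lra.
have : (0 : R) <= 2 ^- (m + k).+1 by rewrite invr_ge0 exprn_ge0.
by case: ifP => _; lra.
Qed.

(** The partial sums are nondecreasing and, by [S_tail] from 0, bounded by 1. *)
Let S_cvg : S @ \oo --> two_pow_neg R C.
Proof.
apply: nondecreasing_is_cvgn S_nd _; exists 1 => _ [n _ <-].
have := S_tail (leq0n n); rewrite {2}/S big_geq // expr0 invr1 add0r.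
by move=> /le_trans; apply; rewrite lerBlDr lerDl invr_ge0 exprn_ge0.
Qed.

Variable E : nat -> nat -> bool.
Hypothesis CE : approximated_by C E.

Let T n : R := \sum_(0 <= b < n.+1 | E b n) 2 ^- b.+1.

(** Horner's scheme on the bits of stage [n]: the result is [2^k] times the sum of the terms with
    [b < k]. *)
Let horner n k := nat_rect (fun=> nat) 0%N (fun b r => (r * 2 + E b n)%N) k.

Let a n : rat := (horner n n.+1)%:R / (2 ^ n.+1)%:R.

Let computable_a : computable_rat_seq a.
Proof.
have [recE _ _ _] := CE.
(* The sign exponent is 0, and the predecessor is taken because the denominator is read as
   [q n + 1]. *)
exists (fun=> 0%N), (fun n => horner n n.+1), (fun n => (2 ^ n.+1).-1)%N; split.
- exact/recursive_fun_seq/recursive_const.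
- apply/recursive_fun_seq; have rec0 := recursive_const None 1 0.
  have recS := recursive_succ (@recursive_var None 1 0 isT).
  apply: (recursive_nat_rect (G := fun b r x => (r * 2 + E b (nth 0 x 0))%N)
    rec0 _ recS).
  apply: recursive_add.
    by apply: recursive_mul; [exact: recursive_var|exact: recursive_const].
  apply: (recursive_app2 (f := fun b n => nat_of_bool (E b n))) => //.
    exact: recursive_var.
  by apply: recursive_seq_ext (@recursive_var _ 3 2 isT) => x _; rewrite nth_drop.
- apply/recursive_fun_seq/recursive_pred; have rec1 := recursive_const None 1 1.
  have recS := recursive_succ (@recursive_var None 1 0 isT).
  apply: recursive_seq_ext
    (recursive_nat_rect (G := fun _ r _ => (r * 2)%N) rec1 _ recS).
    by move=> x _; elim: (nth 0 x 0).+1%N => [|k /= ->] //; rewrite expnSr.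
  by apply: recursive_mul; [exact: recursive_var|exact: recursive_const].
- by move=> n; rewrite expr0 mul1r prednK // expn_gt0.
Qed.

Let ratr_a n : ratr (a n) = T n.
Proof.
have -> : ratr (a n) = (horner n n.+1)%:R / (2 ^ n.+1)%:R :> R.
  by rewrite /a; move: (horner n n.+1) => h; rewrite fmorph_div /= !ratr_nat.
(* Induction on the number of bits, with the stage [n] inside [E b n] kept fixed. *)
rewrite /T; elim: n.+1 => [|k IHk]; first by rewrite big_geq // mul0r.
rewrite big_mkcond big_nat_recr //= -big_mkcond -IHk natrD natrM !natrX.
have k_neq0 : (2 : R) ^+ k != 0 by rewrite expf_neq0.
by case: (E k n) => /=; rewrite exprS; field.
Qed.

Let T_nd : nondecreasing_seq T.
Proof.
have [_ _ E_mono _] := CE.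
apply/nondecreasing_seqP => n.
rewrite /T big_mkcond [leRHS]big_mkcond [leRHS]big_nat_recr //=.
rewrite ler_wpDr //; first by case: ifP => // _; rewrite invr_ge0 exprn_ge0.
apply: ler_sum => b _; case: ifPn => [/E_mono ->//|_].
by case: ifP => // _; rewrite invr_ge0 exprn_ge0.
Qed.

Let T_le n : T n <= two_pow_neg R C.
Proof.
have [_ _ _ CEE] := CE.
apply: le_trans (nondecreasing_cvgn_le S_nd S_cvg n.+1).
rewrite /T /S big_mkcond [leRHS]big_mkcond; apply: ler_sum => b _.
case: ifPn => Ebn; last by case: ifP => // _; rewrite invr_ge0 exprn_ge0.
by rewrite ifT // inE CEE; exists n.
Qed.

(** At a settled stage [T n] equals the true partial sum [S n.+1], so its error is a tail of size at
    most [2^-(n+1)]. *)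
Lemma approximated_by_regaining :
  (forall N, exists2 n, (N <= n)%N & forall b, (b <= n)%N -> C b -> E b n) ->
  regainingly_approximable (two_pow_neg R C).
Proof.
have [_ _ _ CEE] := CE; move=> settled.
have TS n : (forall b, (b <= n)%N -> C b -> E b n) -> T n = S n.+1.
  move=> Cn; rewrite /T /S big_nat_cond [RHS]big_nat_cond; apply: eq_bigl => b.
  rewrite leq0n ltnS /=; have [le_bn|//] := leqP b n; rewrite !andTb.
  apply/idP/idP => [Ebn|/set_mem]; last exact: Cn.
  by apply/mem_set; rewrite CEE; exists n.
exists a; split.
- exact: computable_a.
- by move=> m n le_mn; rewrite -(ler_rat R) !ratr_a T_nd.
- under eq_fun do rewrite ratr_a.
  apply/cvgrPdist_le => /= e e_gt0.
  have /cvgrPdist_le /(_ e e_gt0) [N _ NP] := S_cvg.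
  have [n le_Nn /TS Tn] := settled N.
  (* From the settled stage [n] on, [T k] is squeezed between [S n.+1] and the limit. *)
  exists n => // k /= le_nk; have := NP n.+1 (leqW le_Nn); rewrite -Tn.
  by rewrite !ger0_norm ?subr_ge0 ?T_le //; have := T_nd le_nk; lra.
- apply: infinite_set_natP => N; have [n le_Nn /TS Tn] := settled N.
  exists n => //=; rewrite ratr_a Tn ltrBlDl.
  (* The tail bound is half of the allowed error, which gives the strict inequality. *)
  apply: (@le_lt_trans _ _ (S n.+1 + 2 ^- n.+1)).
    apply: limr_le S_cvg _; exists n.+1 => // k /= le_nk.
    have : (0 : R) <= 2 ^- k by rewrite invr_ge0 exprn_ge0.
    by have := S_tail le_nk; lra.
  by rewrite ltrD2l ltf_pV2 ?posrE ?exprn_gt0 // ltr_eXn2l // ltr1n.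
Qed.

End Regaining.

(** * Dekker deficiency stages *)

Section Deficiency.
Variable f : nat -> nat.

Definition enumerated n a : bool := has (fun i => f i == a) (iota 0 n.+1).

(** As [f] may repeat values, a later smaller value counts only if it was not listed up to stage
    [s]. *)
Definition seen_deficient s n : bool :=
  has (fun t => [&& (s < t)%N, (f t < f s)%N & ~~ enumerated s (f t)])
    (iota 0 n.+1).

Definition deficient : set nat := [set s | exists n, seen_deficient s n]%classic.

Lemma enumeratedP n a : reflect (exists2 i, (i <= n)%N & f i = a) (enumerated n a).
Proof.
apply: (iffP hasP) => [[i]|[i le_in <-]].
  by rewrite mem_iota ltnS => /= le_in /eqP <-; exists i.
by exists i; rewrite // mem_iota.
Qed.

Lemma seen_deficientP s n : reflect
  (exists t, [/\ (t <= n)%N, (s < t)%N, (f t < f s)%N & ~~ enumerated s (f t)])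
  (seen_deficient s n).
Proof.
apply: (iffP hasP) => [[t]|[t [le_tn st fts new_t]]].
  by rewrite mem_iota ltnS => /= le_tn /and3P[]; exists t.
by exists t; rewrite ?mem_iota // st fts.
Qed.

Lemma deficientP s : deficient s <->
  exists t, [/\ (s < t)%N, (f t < f s)%N & ~~ enumerated s (f t)].
Proof.
split=> [[n /seen_deficientP[t [_ *]]]|[t [*]]]; first by exists t.
by exists t; apply/seen_deficientP; exists t.
Qed.

(** An element below [f s] listed only after stage [s] would witness deficiency, and [f s] itself is
    listed at [s]. *)
Lemma not_deficient_enumerated s a : ~ deficient s -> (a <= f s)%N ->
  range f a <-> enumerated s a.
Proof.
move=> ND le_a; split=> [[t _ fta]|/enumeratedP[i _ <-]]; last by exists i.
have [le_ts|lt_st] := leqP t s; first by apply/enumeratedP; exists t.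
move: le_a; rewrite leq_eqVlt => /predU1P[->|lt_a].
  by apply/enumeratedP; exists s.
by apply: contra_notT ND => new_a; apply/deficientP; exists t; rewrite fta.
Qed.

Lemma recursive_enumerated X n G H : computable f -> recursive_seq X n G ->
  recursive_seq X n H -> recursive_seq X n (fun x => enumerated (G x) (H x)).
Proof.
move=> /recursive_fun_seq/partial_recursive_relative recf.
apply: (@recursive_app2 X n (fun s a => nat_of_bool (enumerated s a))).
apply: (recursive_has (p := fun i x => f i == nth 0%N x 1)); last first.
  exact/recursive_succ/recursive_var.
apply: recursive_eq; first exact/(recursive_app1 (recf X))/recursive_var.
by apply: recursive_seq_ext (@recursive_var _ 3 2 isT) => x _; rewrite nth_behead.
Qed.

(** Serves the case of a finite range. The value [f i] enters by stage [maxn i (f i)], because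
    elements above the stage number are withheld. *)
Lemma approximated_by_range : computable f ->
  approximated_by (range f) (fun a n => (a <= n)%N && enumerated n a).
Proof.
move=> cf; split=> [|a n /andP[]//|a n /andP[an /enumeratedP[i le_in fi]]|].
- apply: recursive_and; last first.
    by apply: recursive_enumerated => //; exact: recursive_var.
  by apply: recursive_leq; exact: recursive_var.
- by apply/andP; split; [exact: leqW|apply/enumeratedP; exists i => //; exact: leqW].
- apply/seteqP; split=> [_ [i _ <-]|a [n /andP[_ /enumeratedP[i _ <-]]]];
    last by exists i.
  exists (maxn i (f i)); apply/andP; split; first exact: leq_maxr.
  by apply/enumeratedP; exists i; rewrite // leq_maxl.
Qed.

Lemma approximated_by_deficient : computable f ->
  approximated_by deficient seen_deficient.
Proof.
move=> cf; split=> [|s n|s n|//].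
- have recf : recursive_seq None 1 (fun x => f (nth 0%N x 0)) by exact/recursive_fun_seq.
  pose p t x := [&& nth 0 x 0 < t, f t < f (nth 0 x 0)
    & ~~ enumerated (nth 0 x 0) (f t)]%N.
  apply: (recursive_has (p := p)); last exact/recursive_succ/recursive_var.
  (* The variables are [t], [s], [n] in this order; [behead] had shifted [s] to position 0. *)
  apply: (@recursive_seq_ext _ 3 (fun x => [&& nth 0 x 1 < nth 0 x 0,
     f (nth 0 x 0) < f (nth 0 x 1)
    & ~~ enumerated (nth 0 x 1) (f (nth 0 x 0))]%N)).
    by move=> x _; rewrite /p nth_behead.
  have rec_f i : (i < 3)%N -> recursive_seq None 3 (fun x => f (nth 0%N x i)).
    by move=> lt_i; apply: (recursive_app1 recf); exact: recursive_var.
  apply: recursive_and.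
    by apply: recursive_leq; [apply: recursive_succ|]; exact: recursive_var.
  apply: recursive_and.
    by apply: recursive_leq; [apply: recursive_succ|]; exact: rec_f.
  apply: recursive_neg; apply: recursive_enumerated => //; last exact: rec_f.
  exact: recursive_var.
- by case/seen_deficientP=> t [le_tn /ltnW/leq_trans-> //].
- case/seen_deficientP=> t [le_tn *]; apply/seen_deficientP.
  by exists t; rewrite leqW.
Qed.

(** The search runs over values below [f s], not over stages, so it is bounded once the oracle
    decides membership in the range. *)
Lemma deficient_reducible : computable f -> turing_reducible deficient (range f).
Proof.
move=> cf; apply/recursive_fun_seq.
have recf : recursive_seq (Some (range f)) 1 (fun x => f (nth 0%N x 0)).
  exact/partial_recursive_relative/recursive_fun_seq.
pose p a x := (a \in range f) && ~~ enumerated (nth 0%N x 0) a.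
apply: (@recursive_seq_ext _ _
    (fun x => has (p^~ x) (iota 0 (f (nth 0%N x 0))))).
  move=> x _; congr nat_of_bool; apply/hasP/idP => [[a]|].
    rewrite mem_iota => /= lt_a /andP[/set_mem[t _ fta] new_a].
    apply/mem_set/deficientP; exists t; rewrite fta; split=> //.
    by rewrite ltnNge; apply: contra new_a => le_t; apply/enumeratedP; exists t.
  move=> /set_mem/deficientP[t [lt_t lt_ft new_t]].
  by exists (f t); rewrite ?mem_iota // /p new_t andbT; apply/mem_set; exists t.
apply: recursive_has => //; apply: recursive_and.
  by apply: recursive_mem; exact: recursive_var.
apply: recursive_neg; apply: recursive_enumerated => //; last exact: recursive_var.
by apply: recursive_seq_ext (@recursive_var _ 2 1 isT) => x _; rewrite nth_behead.
Qed.

(** * Nondeficient stages and the recovery of the range from them *)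

Hypothesis unbounded_f : forall N, exists t, (N <= f t)%N.

(* Take the first stage at which the least value not listed before [N] appears. *)
Lemma exists_true_stage N : exists n,
  [/\ (N <= n)%N, ~ deficient n & forall i, (i < n)%N -> f i != f n].
Proof.
have exa : exists a, `[< exists2 t, f t = a & forall i, (i < N)%N -> f i != a >].
  (* A value above the maximum of the first [N] values is new. *)
  have [t lt_t] := unbounded_f (\max_(i < N) f i).+1.
  exists (f t); apply/asboolP; exists t => // i lt_iN; rewrite neq_ltn.
  by rewrite (leq_ltn_trans _ lt_t) // (leq_bigmax (Ordinal lt_iN)).
case: (ex_minnP exa) => a /asboolP[t0 ft0 new_a] a_min.
have ext : exists t, f t == a by exists t0; rewrite ft0.
case: (ex_minnP ext) => n /eqP fn n_min; have le_Nn : (N <= n)%N.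
  by rewrite leqNgt; apply/negP => /new_a; rewrite fn eqxx.
exists n; split=> // [|i lt_in]; last first.
  by rewrite fn; apply/negP => /n_min; rewrite leqNgt lt_in.
move=> /deficientP[t [_ lt_ft /negP[]]]; apply/enumeratedP.
(* A witness [t] has a value below [a] not listed up to [n]. As [N <= n], that value is not listed
   before [N] either, against the minimality of [a]. *)
have [|noN] := pselect (exists2 i, (i < N)%N & f i = f t).
  by move=> [i /leq_trans/(_ le_Nn)/ltnW le_in fi]; exists i.
have /a_min : `[< exists2 s, f s = f t & forall i, (i < N)%N -> f i != f t >].
  by apply/asboolP; exists t => // i lt_iN; apply/eqP => fi; apply: noN; exists i.
by rewrite -fn leqNgt lt_ft.
Qed.

Lemma true_stage_settled n : ~ deficient n ->
  (forall i, (i < n)%N -> f i != f n) ->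
  forall s, (s <= n)%N -> deficient s -> seen_deficient s n.
Proof.
move=> NDn new_n s le_sn Ds; apply/seen_deficientP.
have lt_sn : (s < n)%N.
  by rewrite ltn_neqAle le_sn andbT; apply: contra_notN NDn => /eqP <-.
have [t [lt_st lt_ft new_t]] := (deficientP s).1 Ds.
(* If [f t <= f n], nondeficiency of [n] gives an [i <= n] listing [f t], and [i] is the witness.
   Otherwise [n] is, its value being fresh. *)
have [le_ft|lt_nt] := leqP (f t) (f n).
  have /(not_deficient_enumerated NDn le_ft)/enumeratedP[i le_in fi] : range f (f t).
    by exists t.
  exists i; rewrite fi; split=> //.
  by rewrite ltnNge; apply: contra new_t => le_is; apply/enumeratedP; exists i.
exists n; split=> //; first exact: ltn_trans lt_ft.
apply/enumeratedP => -[i le_is fi].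
by have := new_n i (leq_ltn_trans le_is lt_sn); rewrite fi eqxx.
Qed.

Lemma exists_high_true_stage x : exists n, ~ deficient n /\ (x <= f n)%N.
Proof.
(* Once all values below [x] that ever occur have been listed, a fresh value is at least [x]. *)
suff [N NP] : exists N, forall t, (f t < x)%N -> exists2 i, (i < N)%N & f i = f t.
  have [n [le_Nn NDn new_n]] := exists_true_stage N; exists n; split=> //.
  rewrite leqNgt; apply/negP => /NP[i lt_iN fi].
  by have := new_n i (leq_trans lt_iN le_Nn); rewrite fi eqxx.
elim: x => [|x [N NP]]; first by exists 0%N.
have [[s fs]|nox] := pselect (exists s, f s = x).
  exists (maxn N s.+1) => t; rewrite ltnS leq_eqVlt => /predU1P[ft|/NP[i lt_iN fi]].
    by exists s; rewrite ?fs // leq_max ltnSn orbT.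
  by exists i; rewrite // leq_max lt_iN.
exists N => t; rewrite ltnS leq_eqVlt => /predU1P[ft|/NP//].
by case: nox; exists t.
Qed.

(** To decide [x], the oracle is searched for a nondeficient [s] with [x <= f s]; then [x] is in the
    range iff it is listed up to stage [s]. *)
Lemma reducible_deficient : computable f -> turing_reducible (range f) deficient.
Proof.
move=> cf; apply/recursive_fun_seq.
have recf : recursive_seq (Some deficient) 1 (fun x => f (nth 0%N x 0)).
  exact/partial_recursive_relative/recursive_fun_seq.
have stageP x : exists s, (s \notin deficient) && (x <= f s)%N.
  have [s [NDs le_x]] := exists_high_true_stage x.
  by exists s; rewrite le_x andbT; apply/negP => /set_mem.
pose h x := ex_minn (stageP x).
apply: (@recursive_seq_ext _ _ (fun x => enumerated (h (nth 0%N x 0)) (nth 0%N x 0))).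
  move=> x _; rewrite /h; case: ex_minnP => s /andP[NDs le_x] _.
  have {}NDs : ~ deficient s by move=> /mem_set; apply/negP.
  have sP := not_deficient_enumerated NDs le_x.
  by congr nat_of_bool; apply/idP/idP => [/sP/mem_set|/set_mem/sP].
apply: recursive_enumerated => //; last exact: recursive_var.
apply: (recursive_mu (p := fun s x => (s \notin deficient) && (nth 0 x 0 <= f s)%N)).
  apply: recursive_neg; apply: recursive_and.
    by apply: recursive_neg; apply: recursive_mem; exact: recursive_var.
  apply: recursive_leq; last exact/(recursive_app1 recf)/recursive_var.
  by apply: recursive_seq_ext (@recursive_var _ 2 1 isT) => x _; rewrite nth_behead.
move=> x _; rewrite /h; case: ex_minnP => s sP s_min; split=> // i lt_is.
by apply/negP => /s_min; rewrite leqNgt lt_is.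
Qed.

End Deficiency.

Theorem theorem5p4 (R : realType) (A : set nat) (hA : computably_enumerable A) :
  exists B : set nat,
    regainingly_approximable_set R B /\ turing_equivalent A B.
Proof.
have regaining C E (CE : approximated_by C E) :
    (forall N, exists2 n, (N <= n)%N & forall b, (b <= n)%N -> C b -> E b n) ->
    regainingly_approximable_set R C.
  by move=> /(approximated_by_regaining R CE); split=> //; exact: approximated_by_ce CE.
case: hA => [->|[f [cf ->]]].
  exists set0; split; last by split; exact: turing_reducible_refl.
  (* With no elements to wait for, every stage is settled. *)
  apply: (regaining _ (fun _ _ => false)); last by move=> N; exists N.
  split=> //; first exact: recursive_const.
  by apply/seteqP; split=> // b [].
have [unb|bounded] := pselect (forall N, exists t, (N <= f t)%N).
  exists (deficient f); split.
    apply: regaining (approximated_by_deficient cf) _ => N.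
    have [n [le_Nn NDn new_n]] := exists_true_stage unb N.
    by exists n => //; exact: true_stage_settled.
  by split; [exact: reducible_deficient|exact: deficient_reducible].
exists (range f); split; last by split; exact: turing_reducible_refl.
apply: regaining (approximated_by_range cf) _.
have /existsNP[M fM] := bounded.
(* The range lies below [M], hence is finite, and some stage [N] has listed all of it; every later
   stage is settled. *)
have [N NP] : exists N, forall x, (x < M)%N -> range f x -> enumerated f N x.
  elim: M {fM} => [|M [N NP]]; first by exists 0%N.
  have [[s _ fs]|nox] := pselect (range f M); last first.
    exists N => x; rewrite ltnS leq_eqVlt => /predU1P[->//|]; exact: NP.
  exists (maxn N s) => x; rewrite ltnS leq_eqVlt => /predU1P[-> _|lt_x /(NP _ lt_x)].
    by apply/enumeratedP; exists s; rewrite // leq_maxr.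
  move=> /enumeratedP[i le_iN fi]; apply/enumeratedP; exists i => //.
  by rewrite leq_max le_iN.
move=> K; exists (maxn K N); first exact: leq_maxl.
move=> b -> [t _ ft]; have lt_bM : (b < M)%N.
  by rewrite -ft ltnNge; apply/negP => ?; apply: fM; exists t.
have [|i le_iN fi] := enumeratedP _ _ _ (NP b lt_bM _); first by exists t.
by apply/enumeratedP; exists i; rewrite // leq_max le_iN orbT.
Qed.
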